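(* Let $d\ge 1$ be an integer, let $p>1$, and let $c_p$ be the sharp constant in the inequality $$ C_p(x,y)\ \ge\ c_p\,|y|^p\qquad\text{for all }x,y\in\mathbb{C}^d, $$ that is, $$ c_p=\inf\left\{\frac{C_p(x,y)}{|y|^p}\ :\ x,y\in\mathbb{C}^d,\ y\neq 0\right\}. $$ (i) If $p\ge 2$, then $$ c_p=(p-1)(1-k_0)^p+p\,k_0(1-k_0)^{p-1}+k_0^p>0, $$ where $k_0=\frac{r_0}{1+r_0}$ and $r_0>0$ is the solution of the equation $$ r^{p-1}-(p-1)r-(p-2)=0 $$ (for $p=2$ the equation is satisfied by every $r>0$, and $r_0>0$ may be any of them), and this constant is attained in the case $x=k_0y$, i.e. $C_p(k_0y,y)=c_p|y|^p$ for all $y\in\mathbb{C}^d$. (ii) If $1<p<2$, then $c_p=0$.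
   Context: For $z,w\in\mathbb{C}^d$, $z\cdot w=\sum_{j=1}^d z_jw_j$, $\bar w$ is the componentwise complex conjugate, $|z|=(z\cdot\bar z)^{1/2}$ is the Euclidean norm, and $\Re$ denotes the real part. For $p>1$ and $x,y\in\mathbb{C}^d$, $$ C_p(x,y):=|x|^p-|x-y|^p-p\,|x-y|^{p-2}\,\Re\big((x-y)\cdot\bar y\big), $$ where the last term is read as $0$ when $x=y$. *)

(* Defs.v *)
(* Vectors of C^d are represented as 'rV[R[i]]_d, for an arbitrary realType R. *)
From HB Require Import structures.
From mathcomp Require Import all_boot all_order all_algebra.
From mathcomp Require Import complex.
From mathcomp Require Import all_classical all_reals all_analysis.

Set Implicit Arguments.
Unset Strict Implicit.
Unset Printing Implicit Defensive.

Import Order.TTheory GRing.Theory Num.Theory.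

Local Open Scope classical_set_scope.
Local Open Scope ring_scope.

Section Defs.
Context {R : realType} {d : nat}.
Implicit Types (z w x y : 'rV[R[i]]_d) (p : R).

(* Bilinear, without conjugation. *)
Definition cdot z w : R[i] := \sum_(j < d) z 0 j * w 0 j.

Definition cconj z : 'rV[R[i]]_d := map_mx conjc z.

(* [Re] only converts the type: z . conj z is real and nonnegative. The
   MathComp-Analysis norm `|z| on row vectors is the sup norm, hence a
   separate definition. *)
Definition enorm z : R := Num.sqrt (complex.Re (cdot z (cconj z))).

(* For x = y the last term is a product with Re (0 . conj y) = 0, so it is 0
   whatever the value of 0 `^ (p - 2). *)
Definition Cp p x y : R :=
  enorm x `^ p - enorm (x - y) `^ p
  - p * enorm (x - y) `^ (p - 2) * complex.Re (cdot (x - y) (cconj y)).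

End Defs.

(* [inf] on R is only meaningful for nonempty sets that are bounded below: for
   0 < d the set is nonempty, and boundedness amounts to some inequality
   c * enorm y `^ p <= Cp p x y for all x, y. *)
Definition sharp_const (R : realType) (d : nat) (p : R) : R :=
  inf [set c : R | exists x y : 'rV[R[i]]_d,
                     y != 0 /\ c = Cp p x y / enorm y `^ p].

(* Main.v *)
Require Import Defs.
From HB Require Import structures.
From mathcomp Require Import all_boot all_order all_algebra.
From mathcomp Require Import complex.
From mathcomp Require Import all_classical all_reals all_analysis.
From mathcomp Require Import ring lra.

Set Implicit Arguments.
Unset Strict Implicit.
Unset Printing Implicit Defensive.

Import Order.TTheory GRing.Theory Num.Theory.

Local Open Scope ring_scope.

(** Put a = |x - y|, b = |y|, u = |x| and s = Re ((x - y) . conj y).  Then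
    C_p(x, y) = u^p - a^p - p a^(p-2) s, where u^2 = a^2 + b^2 + 2 s and, by
    Cauchy-Schwarz, |s| <= a b; conversely the vectors x = c y, c complex,
    already realise every extremal configuration of (a, b, s).  So the problem
    is about real numbers.

    Nonnegativity for p > 1 ([Cp_ge0]) is the tangent line inequality for t^p
    at a, together with a u >= Re (x . conj (x - y)) = a^2 + s.

    For p >= 2 and fixed a, b, the function u^p = (a^2 + b^2 + 2 s)^(p/2) is
    convex in s, and C_p is smallest at s = - b^2 / 2, where u = a, or, when
    that value violates s >= - a b (that is, when b > 2 a), at s = - a b, where
    x - y is a negative multiple of y.  Both cases are bounded by a tangent line
    of t^(p/2) ([Cp_real_ge_ratio]).  At s = - a b, with r = (b - a) / a, one
    has C_p = G(r) b^p where
      G(r) = (r^p + p r + p - 1) / (1 + r)^p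
    ([antipodal_ratio]), whereas in the first case C_p / b^p is at least
    G(1) = p 2^(1-p), its value at b = 2 a, where the two regimes meet.
    Hence c_p is the minimum of G over r > 0.
    Now G'(r) = p (1 + r)^(-p-1) h(r) with h(r) = r^(p-1) - (p-1) r - (p-2), and
    h(r) / r = r^(p-2) - (p-1) - (p-2) / r is nondecreasing, strictly if p > 2.
    So a positive zero r0 of h is a minimum of G ([antipodal_ratio_min]), it is
    unique if p > 2, and it exists by the intermediate value theorem.  The ratio
    r0 is realised by x = k0 y with k0 = r0 / (1 + r0), which is the announced
    extremal.

    For 1 < p < 2 the choice s = - b^2 / 2, that is x = (1/2 + i t) y, gives
    C_p = (p/2) |1/2 + i t|^(p-2) |y|^p ([Cp_isosceles]), which tends to 0 as t
    grows because p - 2 < 0. *)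

(** * Real powers and one-variable minimisation *)

(** Convexity of t^q, in the form of the tangent line at v; it is Young's
    inequality for w and v^(q-1) with the conjugate exponents q and q/(q-1). *)
Lemma powR_ge_tangent (R : realType) (q v w : R) :
  1 <= q -> 0 <= v -> 0 <= w ->
  v `^ q + q * v `^ (q - 1) * (w - v) <= w `^ q.
Proof.
move=> q1 v0 w0; move: q1; rewrite le_eqVlt => /predU1P[<-|q1].
  by rewrite subrr powRr0 !powRr1// !mul1r subrKC.
have q0 : 0 < q by lra.
have q'0 : 0 < q - 1 by lra.
have conjq : q^-1 + (q / (q - 1))^-1 = 1 by field; rewrite !gt_eqF.
have := conjugate_powR w0 (powR_ge0 v (q - 1)) q0 (divr_gt0 q0 q'0) conjq.
have -> : (v `^ (q - 1)) `^ (q / (q - 1)) = v `^ q.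
  by rewrite -powRrM mulrCA divff ?mulr1// gt_eqF.
rewrite -(ler_pM2l q0).
have -> : q * (w `^ q / q + v `^ q / (q / (q - 1))) = w `^ q + (q - 1) * v `^ q.
  by field; rewrite !gt_eqF.
have := mulr_powRB1 v0 q0.
set t := v `^ (q - 1); set V := v `^ q; set W := w `^ q; nra.
Qed.

Lemma powRB2_sqr (R : realType) (p a : R) : 0 < a ->
  a `^ (p - 2) * a ^+ 2 = a `^ p.
Proof.
move=> a0; rewrite -powR_mulrn ?ltW// -powRD ?subrK//.
by rewrite (gt_eqF a0) implybT.
Qed.

Lemma mulr_powRB1_gt0 (R : realType) (p a : R) : 0 < a ->
  a * a `^ (p - 1) = a `^ p.
Proof.
move=> a0; rewrite -{1}(powRr1 (ltW a0)) -powRD ?subrKC//.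
by rewrite (gt_eqF a0) implybT.
Qed.

Lemma powRB2_mulr (R : realType) (p a : R) : 0 < a ->
  a `^ (p - 2) * a = a `^ (p - 1).
Proof.
move=> a0; rewrite -{2}(powRr1 (ltW a0)) -powRD; first by congr powR; lra.
by rewrite (gt_eqF a0) implybT.
Qed.

(** The first derivative test, global on the half-line. *)
Lemma min_of_derive_sign (R : realType) (f df : R -> R) (r0 r : R) :
  0 < r0 -> 0 < r ->
  (forall x : R, 0 < x -> is_derive x 1 f (df x)) ->
  (forall x, 0 < x -> x <= r0 -> df x <= 0) ->
  (forall x, r0 <= x -> 0 <= df x) ->
  f r0 <= f r.
Proof.
move=> r00 r_gt0 fdf dfle0 dfge0.
have mvt a b : 0 < a -> a <= b ->
    exists2 c, c \in `[a, b] & f b - f a = df c * (b - a).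
  move=> a0 ab; apply: MVT_segment => // [x|].
    by rewrite in_itv/= => /andP[ax _]; apply/fdf/(lt_trans a0).
  apply: derivable_within_continuous => x; rewrite in_itv/= => /andP[ax _].
  by apply: (@ex_derive _ _ _ _ _ _ (df x)); apply/fdf/(lt_le_trans a0).
have [rr0|r0r] := leP r r0.
  have [c] := mvt _ _ r_gt0 rr0.
  rewrite in_itv/= => /andP[rc cr0] E.
  by rewrite -subr_le0 E mulr_le0_ge0 ?subr_ge0// dfle0// (lt_le_trans r_gt0).
have [c] := mvt _ _ r00 (ltW r0r).
rewrite in_itv/= => /andP[r0c cr] E.
by rewrite -subr_ge0 E mulr_ge0 ?subr_ge0 ?dfge0// ltW.
Qed.

(** * The critical equation *)

(** The function h of the critical equation, equal to the derivative of
    [antipodal_ratio] up to a positive factor. *)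
Definition crit_fun (R : realType) (p r : R) : R :=
  r `^ (p - 1) - (p - 1) * r - (p - 2).

Lemma crit_fun_divE (R : realType) (p r : R) : 0 < r ->
  crit_fun p r = r * (r `^ (p - 2) - (p - 1) - (p - 2) / r).
Proof.
move=> r0; rewrite /crit_fun -powRB2_mulr//; field; exact: lt0r_neq0.
Qed.

(** The quotient h(r) / r is nondecreasing, and the additional term on the left
    makes the growth strict when p > 2, which gives uniqueness of the zero.
    Working with the quotient avoids any derivative of h. *)
Lemma crit_fun_div_le (R : realType) (p r1 r2 : R) :
  2 <= p -> 0 < r1 -> r1 <= r2 ->
  crit_fun p r1 / r1 + (p - 2) * (r1^-1 - r2^-1) <= crit_fun p r2 / r2.
Proof.
move=> p2 r10 r12; have r20 := lt_le_trans r10 r12.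
rewrite !crit_fun_divE// ![_ * (_ - _) / _]mulrAC !divff ?lt0r_neq0// !mul1r.
have : r1 `^ (p - 2) <= r2 `^ (p - 2).
  by apply: ge0_ler_powR; rewrite ?nnegrE//; lra.
lra.
Qed.

Lemma crit_fun_le0 (R : realType) (p r0 r : R) : 2 <= p -> 0 < r -> r <= r0 ->
  crit_fun p r0 = 0 -> crit_fun p r <= 0.
Proof.
move=> p2 r_gt0 rr0 E; have := crit_fun_div_le p2 r_gt0 rr0.
rewrite E mul0r => H.
have : crit_fun p r / r <= 0.
  apply: le_trans H; rewrite lerDl mulr_ge0 ?subr_ge0//.
  by rewrite lef_pV2 ?posrE// (lt_le_trans r_gt0).
by rewrite pmulr_lle0 ?invr_gt0.
Qed.

Lemma crit_fun_ge0 (R : realType) (p r0 r : R) : 2 <= p -> 0 < r0 -> r0 <= r ->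
  crit_fun p r0 = 0 -> 0 <= crit_fun p r.
Proof.
move=> p2 r00 rr0 E; have r_gt0 := lt_le_trans r00 rr0.
have := crit_fun_div_le p2 r00 rr0; rewrite E mul0r add0r => H.
have : 0 <= crit_fun p r / r.
  apply: le_trans H; rewrite mulr_ge0 ?subr_ge0//.
  by rewrite lef_pV2 ?posrE.
by rewrite pmulr_lge0 ?invr_gt0.
Qed.

Lemma crit_fun_uniq (R : realType) (p r1 r2 : R) : 2 < p -> 0 < r1 -> 0 < r2 ->
  crit_fun p r1 = 0 -> crit_fun p r2 = 0 -> r1 = r2.
Proof.
move=> p2.
wlog r12 : r1 r2 / r1 <= r2.
  have [r12 W|/ltW r21 W r10 r20 E1 E2] := leP r1 r2; first exact: W.
  by rewrite (W r2 r1).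
move=> r10 r20 E1 E2; apply/eqP; rewrite eq_le r12/=.
have := crit_fun_div_le (ltW p2) r10 r12.
rewrite E1 E2 !mul0r add0r pmulr_rle0 ?subr_gt0// subr_le0.
by rewrite lef_pV2 ?posrE.
Qed.

Lemma crit_fun_exists (R : realType) (p : R) : 2 < p ->
  exists2 r, 0 < r & crit_fun p r = 0.
Proof.
move=> p2; have p20 : 0 < p - 2 by lra.
(* h(1) = 4 - 2p < 0.  M >= 1 is chosen so that M^(p-2) = (p-1) + (p-2);
   then h(M) / M = (p-2) (1 - 1/M) >= 0. *)
pose M := (2 * p - 3) `^ (p - 2)^-1.
have M1 : 1 <= M.
  by rewrite -(powRr0 (2 * p - 3)) ler_powR ?invr_ge0 ?ltW//; lra.
have M0 : 0 < M by lra.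
have MpE : M `^ (p - 2) = 2 * p - 3.
  by rewrite -powRrM mulVf ?gt_eqF// powRr1//; lra.
have h1 : crit_fun p 1 <= 0 by rewrite /crit_fun powR1; lra.
have hM : 0 <= crit_fun p M.
  rewrite crit_fun_divE// MpE; apply: mulr_ge0; first exact: ltW.
  have : (p - 2) / M <= p - 2 by rewrite ler_pdivrMr// ler_peMr// ltW.
  lra.
have [||r + E] := @IVT _ (crit_fun p) 1 M 0 M1.
- apply: derivable_within_continuous => x; rewrite in_itv/= => /andP[x1 _].
  have x0 : 0 < x by lra.
  rewrite /crit_fun; apply: derivableB => //; apply: derivableB => //.
  by apply: derivable_powR; rewrite in_itv/= x0.
- by rewrite ge_min le_max h1 hM orbT.
by rewrite in_itv/= => /andP[r1 _]; exists r => //; lra.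
Qed.

(** * The ratio on the extremal ray *)

(** The value of C_p(x, y) / |y|^p when x - y is a negative multiple of y and
    x = r (y - x). *)
Definition antipodal_ratio (R : realType) (p r : R) : R :=
  (r `^ p + p * r + (p - 1)) * (1 + r) `^ (- p).

Lemma is_derive_antipodal_ratio (R : realType) (p r : R) : 0 < r ->
  is_derive r 1 (antipodal_ratio p)
    (p * (1 + r) `^ (- p - 1) * crit_fun p r).
Proof.
move=> r0; have r10 : 0 < 1 + r by lra.
have D1 := is_derive1_powR p r0.
have D2 : is_derive r 1 (fun x => (1 + x) `^ (- p)) (- p * (1 + r) `^ (- p - 1)).
  have D3 : is_derive r 1 (cst 1 + id : R -> R) 1.
    by apply: is_derive_eq; rewrite add0r.
  have := @is_derive1_comp _ (fun x => x `^ (- p)) (fun x => 1 + x) r _ _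
    (is_derive1_powR (- p) r10) D3.
  by rewrite mulr1.
have D4 : is_derive r 1 (fun x : R => x `^ p + p * x + (p - 1))
    (p * r `^ (p - 1) + p).
  apply: (is_derive_eq (is_deriveD (is_deriveD D1
    (is_deriveZ p (is_derive_id r 1))) (is_derive_cst (p - 1) r 1))).
  by rewrite addr0 /GRing.scale/= mulr1.
have D6 := is_deriveM D4 D2.
have D7 : is_derive r 1 (antipodal_ratio p) _ := D6.
apply: (is_derive_eq D7).
rewrite /crit_fun /GRing.scale/=.
have -> : (1 + r) `^ (- p) = (1 + r) * (1 + r) `^ (- p - 1).
  by rewrite mulr_powRB1_gt0.
have -> : r `^ p = r * r `^ (p - 1) by rewrite mulr_powRB1_gt0.
ring.
Qed.

Lemma antipodal_ratio_min (R : realType) (p r0 r : R) : 2 <= p ->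
  0 < r0 -> crit_fun p r0 = 0 -> 0 < r ->
  antipodal_ratio p r0 <= antipodal_ratio p r.
Proof.
move=> p2 r00 E r_gt0; have p0 : 0 <= p by lra.
apply: (min_of_derive_sign r00 r_gt0 (@is_derive_antipodal_ratio _ p)).
  move=> x x0 xr0; apply: mulr_ge0_le0; first by rewrite mulr_ge0// powR_ge0.
  exact: (crit_fun_le0 p2 x0 xr0 E).
move=> x r0x; apply: mulr_ge0; first by rewrite mulr_ge0// powR_ge0.
exact: (crit_fun_ge0 p2 r00 r0x E).
Qed.

Lemma antipodal_ratio_gt0 (R : realType) (p r : R) : 1 < p -> 0 < r ->
  0 < antipodal_ratio p r.
Proof.
move=> p1 r0; apply: mulr_gt0; last by rewrite powR_gt0//; lra.
have := powR_ge0 r p; have : 0 < p * r by apply: mulr_gt0; lra.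
lra.
Qed.

(** The closed form of the constant in terms of k is the ratio in terms of r,
    because 1 - k = 1 / (1 + r). *)
Lemma antipodal_ratioE (R : realType) (p r : R) : 1 < p -> 0 < r ->
  let k := r / (1 + r) in
  (p - 1) * (1 - k) `^ p + p * k * (1 - k) `^ (p - 1) + k `^ p
    = antipodal_ratio p r.
Proof.
move=> p1 r0 k; have r10 : 0 < 1 + r by lra.
have kE : 1 - k = (1 + r)^-1 by rewrite /k; field; rewrite gt_eqF.
have kr : k = r * (1 - k) by rewrite kE.
have k0 : 0 <= 1 - k by rewrite kE invr_ge0 ltW.
have -> : p * k * (1 - k) `^ (p - 1) = p * r * (1 - k) `^ p.
  have p0 : 0 < p by lra.
  by rewrite {1}kr -(mulr_powRB1 k0 p0); ring.
have -> : k `^ p = r `^ p * (1 - k) `^ p.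
  by rewrite {1}kr powRM// ltW.
have -> : (1 - k) `^ p = (1 + r) `^ (- p).
  by rewrite kE -(powR_inv1 (ltW r10)) -powRrM mulN1r.
by rewrite /antipodal_ratio; ring.
Qed.

(** * The inequality for the real parameters a, b, u, s *)

Lemma powR_sqr (R : realType) (a q : R) : 0 <= a -> (a ^+ 2) `^ q = a `^ (2 * q).
Proof. by move=> a0; rewrite -powR_mulrn// -powRrM. Qed.

(** The tangent of t^p at a gives u^p - a^p >= p a^(p-2) (a u - a^2), and
    a u >= a^2 + s because (a u)^2 - (a^2 + s)^2 = (a b)^2 - s^2. *)
Lemma Cp_real_ge0 (R : realType) (p a b u s : R) : 1 < p ->
  0 <= a -> 0 <= u -> `|s| <= a * b ->
  u ^+ 2 = a ^+ 2 + b ^+ 2 + 2 * s ->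
  0 <= u `^ p - a `^ p - p * a `^ (p - 2) * s.
Proof.
move=> p1; rewrite le_eqVlt => /predU1P[<-|a0] u0.
  rewrite mul0r normr_le0 => /eqP -> _.
  by rewrite mulr0 subr0 powR0 ?gt_eqF ?subr0 ?powR_ge0//; lra.
move=> sab uE.
have := powR_ge_tangent (ltW p1) (ltW a0) u0.
rewrite -powRB2_mulr//.
have CS : a ^+ 2 + s <= a * u.
  apply: (le_trans (ler_norm _)).
  rewrite -(ler_pXn2r (_ : 0 < 2)%N) ?nnegrE ?normr_ge0 ?mulr_ge0 ?(ltW a0)//.
  rewrite real_normK ?num_real// exprMn uE.
  have : s ^+ 2 <= (a * b) ^+ 2.
    by rewrite -(real_normK (num_real s)) ler_pXn2r ?nnegrE// (le_trans _ sab).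
  by rewrite exprMn; nra.
have : 0 <= p * a `^ (p - 2) * (a * u - (a ^+ 2 + s)).
  by rewrite !mulr_ge0 ?powR_ge0 ?subr_ge0//; lra.
set t := a `^ (p - 2); lra.
Qed.

(** The form with 2^(-(p-2)) is compared with (2 a)^(p-2) when b <= 2 a. *)
Lemma antipodal_ratio1 (R : realType) (p : R) :
  antipodal_ratio p 1 = p / 2 * 2 `^ (- (p - 2)).
Proof.
rewrite /antipodal_ratio powR1.
have -> : 2 `^ (- (p - 2)) = 2 `^ (- p) * 4 :> R.
  have -> : - (p - 2) = - p + 2%:R by lra.
  by rewrite powRD ?powR_mulrn ?pnatr_eq0 ?implybT//; congr (_ * _); lra.
have -> : 1 + 1 = 2 :> R by lra.
lra.
Qed.

(** The reduction, for p >= 2, from arbitrary configurations to the antipodal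
    ones.  Convexity of t^(p/2) bounds u^p from below by its tangent in t = u^2,
    taken at the minimiser of C_p in s: u = a if b <= 2 a, u = b - a if
    b > 2 a. *)
Lemma Cp_real_ge_ratio (R : realType) (p c a b u s : R) : 2 <= p ->
  (forall r : R, 0 < r -> c <= antipodal_ratio p r) ->
  0 <= a -> 0 <= b -> 0 <= u -> `|s| <= a * b ->
  u ^+ 2 = a ^+ 2 + b ^+ 2 + 2 * s ->
  c * b `^ p <= u `^ p - a `^ p - p * a `^ (p - 2) * s.
Proof.
move=> p2 cle; have cle1 := cle 1 ltr01; rewrite antipodal_ratio1 in cle1.
have p0 : 0 < p by lra.
rewrite le_eqVlt => /predU1P[<-|a0].
  (* For a = 0, i.e. x = y, the claim is c <= 1; it follows from
     c <= p 2^(1-p) and the tangent of t^(p-1) at 1, evaluated at 2. *)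
  move=> b0 u0; rewrite mul0r normr_le0 => /eqP ->.
  rewrite mulr0 addr0 expr0n/= add0r => /eqP; rewrite eqrXn2// => /eqP ->.
  rewrite mulr0 subr0 powR0 ?subr0 ?gt_eqF// ler_piMl ?powR_ge0//.
  apply: (le_trans cle1).
  have h2 : 1 + (p - 1) <= 2 `^ (p - 1) :> R.
    have := @powR_ge_tangent R (p - 1) 1 2; rewrite !powR1; lra.
  have -> : - (p - 2) = 1 - (p - 1) by lra.
  rewrite powRB ?pnatr_eq0 ?implybT// powRr1//.
  rewrite mulrA divfK ?pnatr_eq0// ler_pdivrMr ?powR_gt0// mul1r; lra.
move=> b0 u0 sab uE.
have qE (x : R) : 0 <= x -> (x ^+ 2) `^ (p / 2) = x `^ p.
  by move=> x0; rewrite powR_sqr// mulrC divfK ?pnatr_eq0.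
have tE (x : R) : 0 <= x -> (x ^+ 2) `^ (p / 2 - 1) = x `^ (p - 2).
  by move=> x0; rewrite powR_sqr//; congr powR; lra.
have tangent (x : R) : 0 <= x ->
    x `^ p + p / 2 * x `^ (p - 2) * (u ^+ 2 - x ^+ 2) <= u `^ p.
  move=> x0; rewrite -!qE// -tE//.
  by apply: powR_ge_tangent; rewrite ?sqr_ge0//; lra.
(* If b <= 2 a, the tangent at a^2 leaves (p/2) a^(p-2) b^2, and
   a^(p-2) >= (b/2)^(p-2). *)
have [ba|ab] := leP b (2 * a).
  have := tangent _ (ltW a0); rewrite uE.
  suff : c * b `^ p <= p / 2 * a `^ (p - 2) * b ^+ 2.
    set t := a `^ (p - 2); lra.
  move: b0; rewrite le_eqVlt => /predU1P[<-|b0].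
    by rewrite powR0 ?gt_eqF// expr0n/= !mulr0.
  rewrite -(powRB2_sqr p b0) mulrA ler_wpM2r ?sqr_ge0//.
  apply: (le_trans (ler_wpM2r (powR_ge0 _ _) cle1)).
  rewrite -[_ * b `^ _]mulrA ler_wpM2l ?divr_ge0 ?(ltW p0)// powRN mulrC.
  rewrite ler_pdivrMr ?powR_gt0// mulrC -powRM ?(ltW a0)//.
  by apply: ge0_ler_powR; rewrite ?nnegrE//; lra.
(* If b > 2 a, the tangent at (b - a)^2 has slope coefficient (b - a)^(p-2),
   at least a^(p-2), so s may be replaced by - a b. *)
have ba0 : 0 <= b - a by lra.
have := tangent _ ba0; rewrite uE.
have sab0 : 0 <= s + a * b.
  by move: sab; rewrite ler_norml => /andP[]; lra.
have : a `^ (p - 2) <= (b - a) `^ (p - 2).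
  by apply: ge0_ler_powR; rewrite ?nnegrE//; lra.
move=> /(ler_wpM2r sab0)/(ler_wpM2l (ltW p0)).
suff : c * b `^ p <= (b - a) `^ p - a `^ p + p * a `^ (p - 2) * (a * b).
  set t := a `^ (p - 2); set t' := (b - a) `^ (p - 2); lra.
pose r := (b - a) / a.
have r0 : 0 < r by rewrite divr_gt0//; lra.
have r10 : 0 < 1 + r by lra.
have baE : b - a = a * r by rewrite /r mulrC divfK// gt_eqF.
have bE : b = a * (1 + r) by lra.
apply: (le_trans (ler_wpM2r (powR_ge0 _ _) (cle r r0))).
rewrite baE bE.
have -> : p * a `^ (p - 2) * (a * (a * (1 + r))) = p * (1 + r) * a `^ p.
  by rewrite -(powRB2_sqr p a0); ring.
rewrite (powRM p (ltW a0) (ltW r0)) (powRM p (ltW a0) (ltW r10)).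
rewrite /antipodal_ratio powRN.
rewrite le_eqVlt; apply/orP; left; apply/eqP; field.
by rewrite gt_eqF// powR_gt0.
Qed.

(** * The real inner product on C^d and its norm *)

Section HermitianReal.
Context {R : realType} {d : nat}.
Implicit Types (x y z w : 'rV[R[i]]_d) (c : R[i]).

(** The Euclidean inner product of C^d regarded as R^(2d). *)
Definition rdot z w : R := complex.Re (cdot z (cconj w)).

Lemma rdotE z w : rdot z w = \sum_(j < d)
  (complex.Re (z 0 j) * complex.Re (w 0 j) +
   complex.Im (z 0 j) * complex.Im (w 0 j)).
Proof.
rewrite /rdot /cdot (raddf_sum (@complex.Re R)).
apply: eq_bigr => j _; rewrite mxE.
by case: (z 0 j) => a b; case: (w 0 j) => a' b' /=; rewrite mulrN opprK.
Qed.

Lemma rdotC z w : rdot z w = rdot w z.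
Proof. by rewrite !rdotE; apply: eq_bigr => j _; ring. Qed.

Lemma rdotDl x y w : rdot (x + y) w = rdot x w + rdot y w.
Proof.
rewrite !rdotE -big_split; apply: eq_bigr => j _; rewrite mxE /=.
by case: (x 0 j) => a b; case: (y 0 j) => a' b' /=; ring.
Qed.

Lemma rdotZl (t : R) x w : rdot (t%:C%C *: x) w = t * rdot x w.
Proof.
rewrite !rdotE mulr_sumr; apply: eq_bigr => j _; rewrite mxE /=.
by case: (x 0 j) => a b /=; ring.
Qed.

Lemma rdotZ_self c y : rdot (c *: y) y = complex.Re c * rdot y y.
Proof.
rewrite !rdotE mulr_sumr; apply: eq_bigr => j _; rewrite mxE /=.
by case: (y 0 j) => a b; case: c => e f /=; ring.
Qed.

Lemma rdot0l w : rdot 0 w = 0.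
Proof. by rewrite rdotE big1// => j _; rewrite mxE !mul0r addr0. Qed.

Lemma rdotZZ c y : rdot (c *: y) (c *: y) =
  (complex.Re c ^+ 2 + complex.Im c ^+ 2) * rdot y y.
Proof.
rewrite !rdotE mulr_sumr; apply: eq_bigr => j _; rewrite mxE /=.
by case: (y 0 j) => a b; case: c => e f /=; ring.
Qed.

Lemma rdot_ge0 z : 0 <= rdot z z.
Proof.
by rewrite rdotE; apply: sumr_ge0 => j _; rewrite -!expr2 addr_ge0 ?sqr_ge0.
Qed.

Lemma rdot_eq0 z : rdot z z = 0 -> z = 0.
Proof.
rewrite rdotE => /psumr_eq0P H; apply/rowP => j; rewrite mxE.
have : 0 = complex.Re (z 0 j) ^+ 2 + complex.Im (z 0 j) ^+ 2.
  by rewrite -(H _ j)// => k _; rewrite -!expr2 addr_ge0 ?sqr_ge0.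
move=> /esym/eqP; rewrite paddr_eq0 ?sqr_ge0// !sqrf_eq0.
by case: (z 0 j) => a b /= /andP[/eqP-> /eqP->].
Qed.

Lemma sqr_enorm z : enorm z ^+ 2 = rdot z z.
Proof. by rewrite sqr_sqrtr// rdot_ge0. Qed.

Lemma enorm_ge0 z : 0 <= enorm z.
Proof. exact: sqrtr_ge0. Qed.

Lemma enorm0 : enorm (0 : 'rV[R[i]]_d) = 0.
Proof.
by apply/eqP; rewrite -sqrf_eq0 sqr_enorm rdot0l.
Qed.

Lemma enorm_gt0 z : z != 0 -> 0 < enorm z.
Proof.
move=> z0; rewrite lt_neqAle enorm_ge0 andbT eq_sym; apply: contra z0.
by rewrite -sqrf_eq0 sqr_enorm => /eqP/rdot_eq0 ->.
Qed.

Lemma enormZ c y :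
  enorm (c *: y) = Num.sqrt (complex.Re c ^+ 2 + complex.Im c ^+ 2) * enorm y.
Proof.
by rewrite -sqrtrM ?addr_ge0 ?sqr_ge0// -rdotZZ.
Qed.

Lemma sqr_enormD z y :
  enorm (z + y) ^+ 2 = enorm z ^+ 2 + enorm y ^+ 2 + 2 * rdot z y.
Proof.
rewrite !sqr_enorm rdotDl (rdotC z (z + y)) (rdotC y (z + y)) !rdotDl.
by rewrite (rdotC y z); ring.
Qed.

(** With B = |y|^2 and s = <z, y>, expand 0 <= |B z - s y|^2
    = B (|z|^2 B - s^2). *)
Lemma rdot_CauchySchwarz z y : `|rdot z y| <= enorm z * enorm y.
Proof.
have [->|y0] := eqVneq y 0.
  by rewrite rdotC rdot0l normr0 mulr_ge0 ?enorm_ge0.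
rewrite -(ler_pXn2r (_ : 0 < 2)%N) ?nnegrE ?normr_ge0 ?mulr_ge0 ?enorm_ge0//.
rewrite real_normK ?num_real// exprMn !sqr_enorm.
have B0 : 0 < rdot y y by rewrite -sqr_enorm exprn_gt0// enorm_gt0.
pose B := rdot y y; pose s := rdot z y.
have := rdot_ge0 (B%:C%C *: z + (- s)%:C%C *: y).
rewrite !(rdotDl, rdotZl) !(rdotC _ (_ + _)) !(rdotDl, rdotZl).
rewrite (rdotC y z) -/B -/s.
have -> : B * (B * rdot z z + - s * s) + - s * (B * s + - s * B)
  = B * (rdot z z * B - s ^+ 2) by ring.
by rewrite pmulr_rge0// subr_ge0.
Qed.

(** * The functional C_p on vectors *)

Lemma CpE p x y : Cp p x y = enorm x `^ p - enorm (x - y) `^ p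
  - p * enorm (x - y) `^ (p - 2) * rdot (x - y) y.
Proof. by []. Qed.

Lemma sqr_enorm_subD x y :
  enorm x ^+ 2 = enorm (x - y) ^+ 2 + enorm y ^+ 2 + 2 * rdot (x - y) y.
Proof. by rewrite -sqr_enormD subrK. Qed.

Lemma Cp_ge0 p x y : 1 < p -> 0 <= Cp p x y.
Proof.
move=> p1; apply: Cp_real_ge0 p1 _ _ (rdot_CauchySchwarz _ _) _;
  [exact: enorm_ge0..|exact: sqr_enorm_subD].
Qed.

Lemma Cp0 p x : 1 < p -> Cp p x 0 = 0.
Proof.
by move=> p1; rewrite CpE subr0 rdotC rdot0l mulr0 subrr subr0.
Qed.

(** On the ray x = k y, 0 < k < 1, the quotient C_p(x, y) / |y|^p is the
    antipodal ratio with r = k / (1 - k). *)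
Lemma Cp_scale_real p (r : R) y : 1 < p -> 0 < r ->
  Cp p ((r / (1 + r))%:C%C *: y) y = antipodal_ratio p r * enorm y `^ p.
Proof.
move=> p1 r0; rewrite -(antipodal_ratioE p1 r0).
set k := r / (1 + r).
have r10 : 0 < 1 + r by lra.
have k0 : 0 <= k by rewrite divr_ge0 ?ltW.
have kE : 1 - k = (1 + r)^-1 by rewrite /k; field; rewrite gt_eqF.
have k1 : 0 < 1 - k by rewrite kE invr_gt0.
clearbody k.
have xyE : k%:C%C *: y - y = (k - 1)%:C%C *: y.
  by rewrite -{2}(scale1r y) -scalerBl rmorphB.
have nE (t : R) : enorm (t%:C%C *: y) = `|t| * enorm y.
  by rewrite enormZ /= expr0n addr0 sqrtr_sqr.
rewrite CpE xyE !nE rdotZl distrC (ger0_norm k0) (gtr0_norm k1).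
rewrite -sqr_enorm.
have [y0|y0] := eqVneq (enorm y) 0.
  by rewrite y0 expr0n/= !mulr0 powR0 ?mulr0 ?subrr ?subr0// gt_eqF//; lra.
have {}y0 : 0 < enorm y by rewrite lt_neqAle eq_sym y0 enorm_ge0.
rewrite !powRM ?enorm_ge0 ?(ltW k1)// -(powRB2_sqr p y0) -(powRB2_sqr p k1).
rewrite -(powRB2_mulr p k1); ring.
Qed.

(** Here |x| = |x - y| and Re ((x - y) . conj y) = - |y|^2 / 2, so only the last
    term of C_p survives. *)
Lemma Cp_isosceles p t y : 1 < p -> y != 0 ->
  Cp p (Complex (1 / 2) t *: y) y =
  p / 2 * (Num.sqrt (1 / 4 + t ^+ 2)) `^ (p - 2) * enorm y `^ p.
Proof.
move=> p1 /enorm_gt0 y0.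
have xyE : Complex (1 / 2) t *: y - y = Complex (- (1 / 2)) t *: y.
  rewrite -{2}(scale1r y) -scalerBl; congr (_ *: _).
  by apply/eqP; rewrite eq_complex /= subr0 eqxx andbT; apply/eqP; lra.
rewrite CpE xyE rdotZ_self !enormZ /= sqrrN.
have -> : (1 / 2) ^+ 2 = 1 / 4 :> R by lra.
rewrite subrr sub0r powRM ?sqrtr_ge0 ?enorm_ge0// -sqr_enorm -(powRB2_sqr p y0).
ring.
Qed.

End HermitianReal.

(** * The sharp constant *)

Lemma exists_nonzero_row (R : realType) (d : nat) : (0 < d)%N ->
  exists y : 'rV[R[i]]_d, y != 0.
Proof.
move=> d0; exists (const_mx 1).
by apply/eqP => /rowP/(_ (Ordinal d0))/eqP; rewrite !mxE oner_eq0.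
Qed.

Lemma sharp_const_ge (R : realType) (d : nat) (p c : R) : (0 < d)%N ->
  (forall x y : 'rV[R[i]]_d, c * enorm y `^ p <= Cp p x y) ->
  c <= sharp_const d p.
Proof.
move=> d0 cC; apply: lb_le_inf.
  have [y y0] := exists_nonzero_row R d0.
  by exists (Cp p 0 y / enorm y `^ p), 0, y.
move=> _ [x [y [y0 ->]]].
by rewrite ler_pdivlMr ?powR_gt0 ?enorm_gt0.
Qed.

(** The infimum is over a set bounded below by 0, hence a lower bound of it. *)
Lemma sharp_const_le (R : realType) (d : nat) (p : R) (x y : 'rV[R[i]]_d) :
  1 < p -> sharp_const d p * enorm y `^ p <= Cp p x y.
Proof.
move=> p1; have [->|y0] := eqVneq y 0.
  by rewrite Cp0// enorm0 powR0 ?mulr0// gt_eqF//; lra.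
rewrite -ler_pdivlMr ?powR_gt0 ?enorm_gt0//.
apply: ge_inf; last by exists x, y.
exists 0 => _ [x' [y' [y'0 ->]]].
by rewrite divr_ge0 ?powR_ge0 ?Cp_ge0.
Qed.

Lemma sharp_const_root (R : realType) (d : nat) (p r0 : R) : (0 < d)%N ->
  2 <= p -> 0 < r0 -> crit_fun p r0 = 0 ->
  sharp_const d p = antipodal_ratio p r0.
Proof.
move=> d0 p2 r00 E; have p1 : 1 < p by lra.
apply/eqP; rewrite eq_le; apply/andP; split; last first.
  apply: sharp_const_ge => // x y.
  apply: (Cp_real_ge_ratio p2 _ _ _ _ (rdot_CauchySchwarz _ _));
    [by move=> r; exact: antipodal_ratio_min|exact: enorm_ge0..|].
  exact: sqr_enorm_subD.
have [y y0] := exists_nonzero_row R d0.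
have := sharp_const_le ((r0 / (1 + r0))%:C%C *: y) y p1.
by rewrite Cp_scale_real// ler_pM2r// powR_gt0// enorm_gt0.
Qed.

Lemma sharp_const_eq0 (R : realType) (d : nat) (p : R) : (0 < d)%N ->
  1 < p -> p < 2 -> sharp_const d p = 0.
Proof.
move=> d0 p1 p2; apply/eqP; rewrite eq_le; apply/andP; split; last first.
  by apply: sharp_const_ge => // x y; rewrite mul0r Cp_ge0.
set c := sharp_const d p.
have [y y0] := exists_nonzero_row R d0.
have p0 : 0 < p by lra.
have cle (A : R) : 1 <= A -> c <= p / 2 * A `^ (p - 2).
  move=> A1; pose t := Num.sqrt (A ^+ 2 - 1 / 4).
  have tE : 1 / 4 + t ^+ 2 = A ^+ 2 by rewrite sqr_sqrtr; nra.
  have := sharp_const_le (Complex (1 / 2) t *: y) y p1.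
  rewrite Cp_isosceles// tE sqrtr_sqr ger0_norm; last lra.
  by rewrite ler_pM2r// powR_gt0// enorm_gt0.
have [//|c0] := leP c 0.
have cp1 : c / p <= 1.
  rewrite ler_pdivrMr// mul1r.
  by have := cle 1 (lexx 1); rewrite powR1; lra.
have cp0 : 0 < c / p by rewrite divr_gt0.
(* If c > 0, the A >= 1 with A^(p-2) = c / p gives c <= c / 2. *)
have := cle ((c / p) `^ (p - 2)^-1).
rewrite -powRrM mulVf ?powRr1; [|lra|lra].
have -> : p / 2 * (c / p) = c / 2 by field; rewrite gt_eqF.
move=> H; suff : c <= c / 2 by lra.
apply: H.
rewrite -[leLHS](powRr0 (c / p)); apply: ger_powR; first by rewrite cp0.
by rewrite invr_le0; lra.
Qed.

Theorem theorem6 (R : realType) (d : nat) (p : R) (hd : (1 <= d)%N)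
    (hp : 1 < p) :
  let c_p := sharp_const d p in
  [/\ forall x y : 'rV[R[i]]_d, c_p * enorm y `^ p <= Cp p x y,
      2 <= p ->
        [/\ 2 < p ->
              exists! r : R, 0 < r /\ r `^ (p - 1) - (p - 1) * r - (p - 2) = 0,
            p = 2 ->
              forall r : R, 0 < r -> r `^ (p - 1) - (p - 1) * r - (p - 2) = 0
          & forall r0 : R, 0 < r0 ->
              r0 `^ (p - 1) - (p - 1) * r0 - (p - 2) = 0 ->
              let k0 := r0 / (1 + r0) in
              [/\ c_p = (p - 1) * (1 - k0) `^ p
                        + p * k0 * (1 - k0) `^ (p - 1) + k0 `^ p,
                  (p - 1) * (1 - k0) `^ p
                    + p * k0 * (1 - k0) `^ (p - 1) + k0 `^ p > 0
                & forall y : 'rV[R[i]]_d,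
                    Cp p (real_complex R k0 *: y) y = c_p * enorm y `^ p]]
    & p < 2 -> c_p = 0].
Proof.
split; first by move=> x y; exact: sharp_const_le.
  move=> p2; split.
  - move=> p2'; have [r r0 E] := crit_fun_exists p2'.
    exists r; split=> // r' [r'0 E']; exact: crit_fun_uniq p2' r0 r'0 E E'.
  - move=> -> r r0; have -> : 2 - 1 = 1 :> R by lra.
    by rewrite powRr1 ?ltW//; lra.
  - move=> r0 r00 E k0; rewrite antipodal_ratioE//.
    rewrite (sharp_const_root hd p2 r00 E); split=> //.
      exact: antipodal_ratio_gt0.
    by move=> y; exact: Cp_scale_real.
exact: sharp_const_eq0.
Qed.
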